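(* Let $m,n\ge 1$, let $v\in\mathcal{S}(\mathbb{R}^m,\mathcal{S}_n')$ be a Schwartz family and let $f\in\mathcal{O}_M^{(m)}$. Then the family $fv=(f(p)v_p)_{p\in\mathbb{R}^m}$ belongs to $\mathcal{S}(\mathbb{R}^m,\mathcal{S}_n')$. Moreover $$(fv)^{\wedge}=f\,\widehat{v},$$ where $f\widehat v=M_f\circ\widehat v$. Consequently $${}^t\big((fv)^{\wedge}\big)={}^t\widehat{v}\circ{}^tM_f,$$ or equivalently $$\int_{\mathbb{R}^m}a(fv)=\int_{\mathbb{R}^m}(fa)v\qquad\text{for every }a\in\mathcal{S}_m'.$$
   Context: Let $\mathbb{K}$ be $\mathbb{R}$ or $\mathbb{C}$. $\mathcal{S}_n=\mathcal{S}(\mathbb{R}^n,\mathbb{K})$ is the Schwartz space of rapidly decreasing smooth functions with its usual topology, and $\mathcal{S}_n'$ is its topological dual (tempered distributions). $\mathcal{O}_M^{(m)}$ is the space of all $f\in C^\infty(\mathbb{R}^m,\mathbb{K})$ such that $\phi f\in\mathcal{S}_m$ for every $\phi\in\mathcal{S}_m$. For $f\in\mathcal{O}_M^{(m)}$, $M_f:\mathcal{S}_m\to\mathcal{S}_m$, $M_f(g)=fg$, is the (continuous) multiplication operator; its transpose ${}^tM_f:\mathcal{S}_m'\to\mathcal{S}_m'$ is the multiplication $a\mapsto fa$, $(fa)(g)=a(fg)$. $\mathcal{S}(\mathbb{R}^m,\mathcal{S}_n')$ is the set of Schwartz families ($^{\mathcal S}$families): families $v=(v_p)_{p\in\mathbb{R}^m}$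 in $\mathcal{S}_n'$ such that for every $\phi\in\mathcal{S}_n$ the function $v(\phi):\mathbb{R}^m\to\mathbb{K}$, $p\mapsto v_p(\phi)$, belongs to $\mathcal{S}_m$. The operator associated with $v$ is the (continuous linear) map $\widehat v=v^{\wedge}:\mathcal{S}_n\to\mathcal{S}_m$, $\widehat v(\phi)=v(\phi)$. The superposition of $v$ with coefficient distribution $a\in\mathcal{S}_m'$ is $\int_{\mathbb{R}^m}av:={}^t\widehat v(a)=a\circ\widehat v\in\mathcal{S}_n'$. *)

(* Defs.v *)
From HB Require Import structures.
From mathcomp Require Import all_boot all_order all_algebra.
From mathcomp Require Import all_classical all_reals all_analysis.
From mathcomp Require Import complex ring lra.
Set Implicit Arguments.
Unset Strict Implicit.
Unset Printing Implicit Defensive.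
Import Order.TTheory GRing.Theory Num.Theory.
Import numFieldNormedType.Exports.
Local Open Scope classical_set_scope.
Local Open Scope ring_scope.

(* [Rcomplex R] is [R[i]] seen as an [R]-module, with the modulus
   sqrt (a ^ 2 + b ^ 2) as an [R]-valued norm. *)
Section Rcomplex_normed.
Variable R : realType.

Lemma Rcomplex_normrZ (l : R) (x : Rcomplex R) : `| l *: x | = `| l | * `| x |.
Proof.
case: x => a b; rewrite /Num.norm /= !exprMn -mulrDr sqrtrM ?sqr_ge0//.
by rewrite sqrtr_sqr.
Qed.

HB.instance Definition _ :=
  PseudoMetric.copy (Rcomplex R) (pseudoMetric_normed (Rcomplex R)).
HB.instance Definition _ := isPointed.Build (Rcomplex R) 0.
HB.instance Definition _ := NormedZmod_PseudoMetric_eq.Build R (Rcomplex R) erefl.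
HB.instance Definition _ :=
  PseudoMetricNormedZmod_Lmodule_isNormedModule.Build R (Rcomplex R) Rcomplex_normrZ.

Lemma Rcomplex_normE (a b : R) :
  `|(a +i* b)%C : Rcomplex R| = Num.sqrt (a ^+ 2 + b ^+ 2).
Proof. by []. Qed.

Lemma Rcomplex_Re_le (z : Rcomplex R) : `|complex.Re z| <= `|z|.
Proof.
case: z => a b; rewrite Rcomplex_normE -[leLHS]sqrtr_sqr ler_sqrt ?addr_ge0 ?sqr_ge0//.
by rewrite lerDl sqr_ge0.
Qed.

Lemma Rcomplex_Im_le (z : Rcomplex R) : `|complex.Im z| <= `|z|.
Proof.
case: z => a b; rewrite Rcomplex_normE -[leLHS]sqrtr_sqr.
by rewrite ler_sqrt ?addr_ge0 ?sqr_ge0// lerDr sqr_ge0.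
Qed.

Lemma Rcomplex_le_ReIm (z : Rcomplex R) :
  `|z| <= `|complex.Re z| + `|complex.Im z|.
Proof.
case: z => a b.
have -> : (a +i* b)%C = ((a +i* 0)%C : Rcomplex R) + ((0 +i* b)%C : Rcomplex R).
  by rewrite /GRing.add /= addr0 add0r.
rewrite (le_trans (ler_normD _ _))// !Rcomplex_normE.
by rewrite expr0n /= mulr0n !addr0 !add0r !sqrtr_sqr.
Qed.

End Rcomplex_normed.

Variant scalar_kind := RealScalars | ComplexScalars.

Definition scalars_normed (R : realType) (k : scalar_kind) : normedModType R :=
  match k with RealScalars => R | ComplexScalars => Rcomplex R end.

(* The scalar field K: the reals or the complex numbers.  It is used both as a
   normed space over [R], so that functions 'rV[R]_n -> K can be differentiated
   along real directions, and as a field acting on functions and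
   distributions. *)
Definition scalars (R : realType) (k : scalar_kind) : Type := scalars_normed R k.
HB.instance Definition _ R k := NormedModule.copy (scalars R k) (scalars_normed R k).

Section scalars_field.
Variables (R : realType) (k : scalar_kind).
Implicit Types x y z : scalars R k.

Definition scalars_one : scalars R k :=
  match k return scalars R k with RealScalars => (1 : R) | ComplexScalars => (1 : R[i]) end.
Definition scalars_mul : scalars R k -> scalars R k -> scalars R k :=
  match k return scalars R k -> scalars R k -> scalars R k with
  | RealScalars => fun x y : R => x * y | ComplexScalars => fun x y : R[i] => x * y end.
Definition scalars_inv : scalars R k -> scalars R k :=
  match k return scalars R k -> scalars R k with
  | RealScalars => fun x : R => x^-1 | ComplexScalars => fun x : R[i] => x^-1 end.

Let mulA : associative scalars_mul.
Proof. by rewrite /scalars_mul; case: k => x y z; exact: mulrA. Qed.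
Let mulC : commutative scalars_mul.
Proof. by rewrite /scalars_mul; case: k => x y; exact: mulrC. Qed.
Let mul1 : left_id scalars_one scalars_mul.
Proof. by rewrite /scalars_mul /scalars_one; case: k => x; exact: mul1r. Qed.
Let mulD : left_distributive scalars_mul +%R.
Proof. by rewrite /scalars_mul /scalars_one; case: k => x y z; exact: mulrDl. Qed.
Let one_neq0 : scalars_one != 0.
Proof. by rewrite /scalars_one; case: k; exact: oner_neq0. Qed.

HB.instance Definition _ := GRing.Zmodule_isComNzRing.Build (scalars R k)
  mulA mulC mul1 mulD one_neq0.

Let mulV x : x != 0 -> scalars_mul (scalars_inv x) x = scalars_one.
Proof.
by move: x; rewrite /scalars_mul /scalars_inv /scalars_one; case: k => x; exact: mulVf.
Qed.
Let inv0 : scalars_inv 0 = 0.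
Proof. by rewrite /scalars_inv; case: k; exact: invr0. Qed.

HB.instance Definition _ := GRing.ComNzRing_isField.Build (scalars R k) mulV inv0.
End scalars_field.

Section scalars_theory.
Variables (R : realType) (k : scalar_kind).
Local Notation K := (scalars R k).
Implicit Types x y : K.

Lemma scalars_normM x y : `|x * y| = `|x| * `|y|.
Proof.
rewrite /GRing.mul /= /scalars_mul; move: x y; case: k => x y.
  exact: normrM.
exact: Normc.normcM.
Qed.

Lemma scalars_scaleAl (a : R) x y : a *: (x * y) = (a *: x) * y.
Proof.
rewrite /GRing.mul /= /scalars_mul; move: x y; case: k => x y.
  exact: mulrA.
exact: (@scalerAl R (Rcomplex R)).
Qed.

Lemma scalars_scaleAr (a : R) x y : a *: (x * y) = x * (a *: y).
Proof. by rewrite mulrC scalars_scaleAl mulrC. Qed.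

Lemma scalars_norm1 : `|1 : K| = 1 :> R.
Proof.
have : `|1 : K| * `|1 : K| = `|1 : K| * 1 :> R by rewrite -scalars_normM !mulr1.
by apply: mulfI; rewrite normr_eq0 oner_eq0.
Qed.

Lemma scalars_coord : exists c d : K -> R,
  [/\ forall (a : R) x y, c (a *: x + y) = a * c x + c y,
      forall (a : R) x y, d (a *: x + y) = a * d x + d y,
      forall x, `|c x| <= `|x|, forall x, `|d x| <= `|x| &
      forall x, `|x| <= `|c x| + `|d x|].
Proof.
rewrite /scalars; case: k => /=.
  exists id, (fun=> 0); split=> //.
  - by move=> a _ _; rewrite mulr0 addr0.
  - by move=> x; rewrite normr0.
  - by move=> x; rewrite normr0 addr0.
exists (@complex.Re R), (@complex.Im R); split.
- by move=> a [? ?] [? ?].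
- by move=> a [? ?] [? ?].
- exact: Rcomplex_Re_le.
- exact: Rcomplex_Im_le.
- exact: Rcomplex_le_ReIm.
Qed.

Lemma real_complete (u : nat -> R) :
  (forall e : R, 0 < e -> exists N, forall i j, (N <= i)%N -> (N <= j)%N ->
    `|u i - u j| <= e) ->
  exists l, forall e : R, 0 < e -> exists N, forall i, (N <= i)%N ->
    `|u i - l| <= e.
Proof.
move=> uC; have /cauchy_cvgP/cvg_ex[l /cvgrPdist_le ul] : cauchy (u @ \oo).
  apply/cauchy_exP => e e0; have [N uN] := uC (e / 2) (divr_gt0 e0 (ltr0Sn _ 1)).
  exists (u N), N => // i /= Ni; rewrite -ball_normE /=.
  by rewrite (le_lt_trans (uN _ _ _ _))// ltr_pdivrMr// ltr_pMr// ltr1n.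
exists l => e /ul[N _ uN]; exists N => i /uN; by rewrite distrC.
Qed.

Lemma scalars_complete (u : nat -> K) :
  (forall e : R, 0 < e -> exists N, forall i j, (N <= i)%N -> (N <= j)%N ->
    `|u i - u j| <= e) ->
  exists l, forall e : R, 0 < e -> exists N, forall i, (N <= i)%N ->
    `|u i - l| <= e.
Proof.
move: u; rewrite /scalars; case: k => /= u; first exact: real_complete.
move=> uC.
have ReB (z w : Rcomplex R) : complex.Re (z - w) = complex.Re z - complex.Re w.
  by case: z w => ? ? [].
have ImB (z w : Rcomplex R) : complex.Im (z - w) = complex.Im z - complex.Im w.
  by case: z w => ? ? [].
have [|a ua] := @real_complete (fun i => complex.Re (u i)).
  move=> e /uC[N uN]; exists N => i j Ni Nj.
  by rewrite -ReB (le_trans (Rcomplex_Re_le _))// uN.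
have [|b ub] := @real_complete (fun i => complex.Im (u i)).
  move=> e /uC[N uN]; exists N => i j Ni Nj.
  by rewrite -ImB (le_trans (Rcomplex_Im_le _))// uN.
exists (a +i* b)%C => e e0.
have [N1 uN1] := ua _ (divr_gt0 e0 (ltr0Sn _ 1)).
have [N2 uN2] := ub _ (divr_gt0 e0 (ltr0Sn _ 1)).
exists (maxn N1 N2) => i; rewrite geq_max => /andP[/uN1 h1 /uN2 h2].
by rewrite (le_trans (Rcomplex_le_ReIm _))// ReB ImB /= [leRHS](splitr e) lerD.
Qed.

End scalars_theory.

Section smooth_functions.
Variables (R : realType) (k : scalar_kind) (n : nat).
Local Notation K := (scalars R k).
Implicit Types (f g : 'rV[R]_n -> K) (i : 'I_n) (s : seq 'I_n).

(* For s = [:: i1; ...; ir], the iterated partial derivative d_i1 ... d_ir f. *)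
Definition partial s f : 'rV[R]_n -> K :=
  foldr (fun i g => 'D_('e_i) g) f s.

(* f is C^oo: all its iterated partial derivatives exist and are continuous. *)
Definition smooth f := forall s,
  (forall i x, derivable (partial s f) x 'e_i) /\ continuous (partial s f).

Definition monomial (a : {ffun 'I_n -> nat}) (x : 'rV[R]_n) : R :=
  \prod_i x 0 i ^+ a i.

(* An index (a, s) stands for the weight x ^ a and the derivative [partial s].
   Words s replace multi-indices of derivation; for a smooth function
   [partial s] only depends on the multiplicities of the letters of s, so the
   family of seminorms below is the usual one, with repetitions. *)
Definition schwartz_index : countType :=
  ({ffun 'I_n -> nat} * seq 'I_n)%type.

Definition weighted_partial (j : schwartz_index) f (x : 'rV[R]_n) : K :=
  monomial j.1 x *: partial j.2 f x.

Definition rapidly_decreasing f := forall j,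
  exists M : R, forall x, `|weighted_partial j f x| <= M.

Definition seminorm (j : schwartz_index) f : R :=
  sup (range (fun x => `|weighted_partial j f x|)).

Lemma derive_scalarM (c : K) f x v : derivable f x v ->
  is_derive x v (fun y => c * f y) (c * 'D_v f x).
Proof.
move=> /cvg_ex[/= l fl].
have Dl : 'D_v f x = l by exact/cvg_lim.
have cl : (fun h => h^-1 *: (((fun y => c * f y) \o shift x) (h *: v) - c * f x))
    @ 0^' --> c * l.
  have -> : (fun h => h^-1 *: (((fun y => c * f y) \o shift x) (h *: v) - c * f x))
      = (fun h => c * (h^-1 *: ((f \o shift x) (h *: v) - f x))).
    by apply/funext => h /=; rewrite -mulrBr scalars_scaleAr.
  have [->|c0] := eqVneq c 0.
    by rewrite mul0r; under eq_fun do rewrite mul0r; exact: cvg_cst.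
  apply/cvgrPdist_lt => e e0.
  have c0' : 0 < `|c| by rewrite normr_gt0.
  have /cvgrPdist_lt/(_ (e / `|c|)) := fl.
  rewrite divr_gt0// => /(_ isT); apply: filterS => h /= hl.
  by rewrite -mulrBr scalars_normM mulrC -ltr_pdivlMr.
by apply: DeriveDef; [apply/cvg_ex; exists (c * l)|rewrite Dl; exact/cvg_lim].
Qed.

Lemma continuous_scalarM (T : topologicalType) (c : K) (f : T -> K) :
  continuous f -> continuous (fun y => c * f y).
Proof.
move=> cf x; have [->|c0] := eqVneq c 0.
  by under eq_fun do rewrite mul0r; exact: cvg_cst.
apply/cvgrPdist_lt => e e0.
have c0' : 0 < `|c| by rewrite normr_gt0.
have /cvgrPdist_lt/(_ (e / `|c|)) := cf x.
rewrite divr_gt0// => /(_ isT); apply: filterS => h /= hl.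
by rewrite -mulrBr scalars_normM mulrC -ltr_pdivlMr.
Qed.

Lemma continuous_linear_comb (T : topologicalType) (c : K) (f g : T -> K) :
  continuous f -> continuous g -> continuous (fun y => c * f y + g y).
Proof.
move=> cf cg x; apply: (@cvgD _ _ _ _ _ (fun y => c * f y) g).
  exact: (@continuous_scalarM _ c _ cf).
exact: cg.
Qed.

Lemma partial_linear (c : K) f g s : smooth f -> smooth g ->
  partial s (fun x => c * f x + g x) = fun x => c * partial s f x + partial s g x.
Proof.
move=> sf sg; elim: s => [//|i s IH] /=.
rewrite IH; apply/funext => x.
have := @derive_scalarM c _ x 'e_i ((sf s).1 i x) => cf.
have -> := @deriveD _ _ _ (fun y => c * partial s f y) (partial s g) x 'e_i
  (@ex_derive _ _ _ _ _ _ _ cf) ((sg s).1 i x).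
by rewrite (@derive_val _ _ _ _ _ _ _ cf).
Qed.

Lemma smooth_linear (c : K) f g : smooth f -> smooth g ->
  smooth (fun x => c * f x + g x).
Proof.
move=> sf sg s; rewrite partial_linear//; split=> [i x|].
  apply: (@derivableD _ _ _ (fun y => c * partial s f y) (partial s g)).
    by have /derive_scalarM-/(_ c)[] := (sf s).1 i x.
  exact: (sg s).1.
exact: (continuous_linear_comb (sf s).2 (sg s).2).
Qed.

Lemma partial0 s : partial s (fun=> 0 : K) = fun=> 0.
Proof.
by elim: s => [//|i s /= ->]; apply/funext => x; rewrite (derive_cst (0 : K)).
Qed.

Lemma smooth0 : smooth (fun=> 0 : K).
Proof.
move=> s; rewrite partial0; split=> [i x|]; last exact: (@cst_continuous _ _ (0 : K)).
exact: (derivable_cst (0 : K)).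
Qed.

Lemma weighted_partial_linear j (c : K) f g x : smooth f -> smooth g ->
  weighted_partial j (fun x => c * f x + g x) x =
  c * weighted_partial j f x + weighted_partial j g x.
Proof.
by move=> sf sg; rewrite /weighted_partial partial_linear// scalerDr scalars_scaleAr.
Qed.

Lemma weighted_partial0 j x : weighted_partial j (fun=> 0 : K) x = 0.
Proof. by rewrite /weighted_partial partial0 scaler0. Qed.

Definition schwartz_fun : {pred 'rV[R]_n -> K^o} :=
  mem [set f | smooth f /\ rapidly_decreasing f].

Lemma schwartz_funP (f : 'rV[R]_n -> K^o) :
  f \in schwartz_fun <-> smooth f /\ rapidly_decreasing f.
Proof. by rewrite /schwartz_fun; split=> [/set_mem|?]//; exact/mem_set. Qed.

Lemma schwartz_submod_closed : submod_closed schwartz_fun.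
Proof.
split.
  apply/schwartz_funP; split; first exact: smooth0.
  by move=> j; exists 0 => x; rewrite weighted_partial0 normr0.
move=> c f g /schwartz_funP[sf rf] /schwartz_funP[sg rg]; apply/schwartz_funP.
split; first exact: smooth_linear.
move=> j; have [Mf fM] := rf j; have [Mg gM] := rg j.
exists (`|c| * Mf + Mg) => x; rewrite weighted_partial_linear//.
by rewrite (le_trans (ler_normD _ _))// scalars_normM lerD// ler_wpM2l.
Qed.

HB.instance Definition _ :=
  GRing.isSubmodClosed.Build _ _ schwartz_fun schwartz_submod_closed.

(* The values are taken in [K^o], the regular [K]-module, to make the
   space of functions a [K]-module. *)
Record schwartz := Schwartz {
  schwartz_val :> 'rV[R]_n -> K^o;
  schwartz_valP : schwartz_val \in schwartz_fun }.

HB.instance Definition _ := [isSub for schwartz_val].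
HB.instance Definition _ := [Choice of schwartz by <:].
HB.instance Definition _ := [SubChoice_isSubLmodule of schwartz by <:].

End smooth_functions.

Arguments schwartz_fun R k n : clear implicits.
Arguments schwartz R k n : clear implicits.

Section schwartz_topology.
Variables (R : realType) (k : scalar_kind) (n : nat).
Local Notation K := (scalars R k).
Local Notation S := (schwartz R k n).
Implicit Types (phi psi : S) (j : schwartz_index n).

Lemma schwartz_smooth phi : smooth phi.
Proof. by have /schwartz_funP[] := schwartz_valP phi. Qed.

Lemma schwartz_rapid phi : rapidly_decreasing phi.
Proof. by have /schwartz_funP[] := schwartz_valP phi. Qed.

Lemma le_seminorm j phi x : `|weighted_partial j phi x| <= seminorm j phi.
Proof.
apply: ub_le_sup; last by exists x.
by have [M phiM] := schwartz_rapid phi j; exists M => _ [y _ <-].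
Qed.

Lemma seminorm_le j (f : 'rV[R]_n -> K) (M : R) :
  (forall x, `|weighted_partial j f x| <= M) -> seminorm j f <= M.
Proof.
move=> fM; apply: ge_sup; first by exists `|weighted_partial j f 0|, 0.
by move=> _ [x _ <-].
Qed.

Lemma seminorm_ge0 j phi : 0 <= seminorm j phi.
Proof. exact: le_trans (normr_ge0 _) (le_seminorm j phi 0). Qed.

Lemma seminorm0 j : seminorm j (0 : S) = 0.
Proof.
apply/eqP; rewrite eq_le seminorm_ge0 andbT; apply: seminorm_le => x.
by rewrite weighted_partial0 normr0.
Qed.

Lemma seminormD j phi psi : seminorm j (phi + psi : S) <= seminorm j phi + seminorm j psi.
Proof.
apply: seminorm_le => x.
have -> : (phi + psi : S) = (fun x => 1 * (phi : _ -> K) x + (psi : _ -> K) x) :> (_ -> K).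
  by apply/funext => y; rewrite mul1r.
rewrite weighted_partial_linear ?mul1r; [|exact: schwartz_smooth..].
by rewrite (le_trans (ler_normD _ _))// lerD// le_seminorm.
Qed.

Lemma seminormZ_le j (c : K) phi : seminorm j (c *: phi : S) <= `|c| * seminorm j phi.
Proof.
apply: seminorm_le => x.
have -> : (c *: phi : S) = (fun x => c * (phi : _ -> K) x + (0 : K)) :> (_ -> K).
  by apply/funext => y; rewrite addr0.
rewrite weighted_partial_linear; [|exact: schwartz_smooth|exact: smooth0].
by rewrite weighted_partial0 addr0 scalars_normM ler_wpM2l// le_seminorm.
Qed.

Lemma seminormN j phi : seminorm j (- phi : S) = seminorm j phi.
Proof.
have le psi : seminorm j (- psi : S) <= seminorm j psi.
  by rewrite -scaleN1r (le_trans (seminormZ_le _ _ _))// normrN scalars_norm1 mul1r.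
by apply/eqP; rewrite eq_le le; have := le (- phi); rewrite opprK.
Qed.

Lemma seminormB j phi psi : seminorm j (phi - psi : S) = seminorm j (psi - phi : S).
Proof. by rewrite -seminormN opprB. Qed.

(* The topology generated by the seminorms: the neighbourhoods of phi are the
   sets containing some finite intersection of seminorm balls around phi. *)
Definition seminorm_ball phi (F : seq (schwartz_index n)) (e : R) : set S :=
  [set psi : S | forall j, j \in F -> seminorm j (psi - phi : S) < e].

Definition schwartz_nbhs phi : set_system S :=
  [set A | exists F e, 0 < e /\ seminorm_ball phi F e `<=` A].

HB.instance Definition _ := hasNbhs.Build S schwartz_nbhs.

Let nbhs_filter phi : ProperFilter (nbhs phi).
Proof.
apply: Build_ProperFilter_ex => [A [F [e [e0 FA]]]|].
  by exists phi; apply: FA => j _; rewrite subrr seminorm0.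
split; first by exists [::], 1.
  move=> A B [F [e [e0 FA]]] [G [d [d0 GB]]].
  exists (F ++ G), (Num.min e d); split; first by rewrite lt_min e0.
  by move=> psi H; split; [apply: FA|apply: GB] => j jF;
    have := H j; rewrite mem_cat jF ?orbT lt_min => /(_ isT)/andP[].
by move=> A B AB [F [e [e0 FA]]]; exists F, e; split=> // psi /FA /AB.
Qed.

Let nbhs_singleton phi A : nbhs phi A -> A phi.
Proof.
by move=> [F [e [e0 FA]]]; apply: FA => j _; rewrite subrr seminorm0.
Qed.

Let nbhs_nbhs phi A : nbhs phi A -> nbhs phi (nbhs^~ A).
Proof.
move=> [F [e [e0 FA]]]; exists F, (e / 2); split; first exact: divr_gt0.
move=> psi H; exists F, (e / 2); split; first exact: divr_gt0.
move=> chi H'; apply: FA => j jF.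
rewrite -(subrK psi chi) -addrA (le_lt_trans (seminormD _ _ _))//.
by rewrite [ltRHS]splitr ltrD ?H ?H'.
Qed.

HB.instance Definition _ :=
  Nbhs_isNbhsTopological.Build S nbhs_filter nbhs_singleton nbhs_nbhs.

Definition tempered_fun : {pred S -> K^o} :=
  mem [set u : S -> K^o | linear u /\ continuous (u : S -> K)].

Lemma tempered_funP (u : S -> K^o) :
  u \in tempered_fun <-> linear u /\ continuous (u : S -> K).
Proof. by rewrite /tempered_fun; split=> [/set_mem|?]//; exact/mem_set. Qed.

Lemma tempered_submod_closed : submod_closed tempered_fun.
Proof.
split.
  apply/tempered_funP; split; last exact: (@cst_continuous _ _ (0 : K)).
  by move=> c phi psi; rewrite scaler0 addr0.
move=> c u w /tempered_funP[lu cu] /tempered_funP[lw cw]; apply/tempered_funP.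
split=> [d phi psi /=|].
  change (c *: u (d *: phi + psi) + w (d *: phi + psi) =
    d *: (c *: u phi + w phi) + (c *: u psi + w psi)).
  rewrite lu lw.
  rewrite !scalerDr addrACA; congr (_ + _ + (_ + _)).
  by rewrite !scalerA mulrC.
exact: (@continuous_linear_comb R k _ c _ _ cu cw).
Qed.

HB.instance Definition _ :=
  GRing.isSubmodClosed.Build _ _ tempered_fun tempered_submod_closed.

(* The topological dual of the Schwartz space. *)
Record tempered := Tempered {
  tempered_val :> S -> K^o;
  tempered_valP : tempered_val \in tempered_fun }.

HB.instance Definition _ := [isSub for tempered_val].
HB.instance Definition _ := [Choice of tempered by <:].
HB.instance Definition _ := [SubChoice_isSubLmodule of tempered by <:].

End schwartz_topology.
Arguments tempered_fun R k n : clear implicits.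
Arguments tempered R k n : clear implicits.

Section taylor.
Variable R : realType.

Lemma mvt_between (g dg : R -> R) (a b : R) :
  (forall t : R, is_derive t 1 g (dg t)) ->
  exists2 c, `|c - a| <= `|b - a| & g b - g a = dg c * (b - a).
Proof.
move=> Dg.
have cg : continuous g.
  by move=> t; apply: differentiable_continuous; apply/derivable1_diffP; exact: ex_derive.
have [ab|/ltW ba] := leP a b.
  have [c + E] := MVT_segment ab (fun x _ => Dg x) (continuous_subspaceT cg).
  rewrite in_itv /= => /andP[ac cb]; exists c => //.
  by rewrite !ger0_norm ?subr_ge0// lerB.
have [c + E] := MVT_segment ba (fun x _ => Dg x) (continuous_subspaceT cg).
rewrite in_itv /= => /andP[bc ca]; exists c.
  by rewrite !ler0_norm ?subr_le0// lerN2 lerB.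
by rewrite -opprB E -mulrN opprB.
Qed.

Lemma taylor2_real (g dg ddg : R -> R) (M h : R) :
  (forall t : R, is_derive t 1 g (dg t)) -> (forall t : R, is_derive t 1 dg (ddg t)) ->
  (forall t : R, `|ddg t| <= M) ->
  `|g h - g 0 - h * dg 0| <= M * `|h| ^+ 2.
Proof.
move=> Dg Ddg ddgM.
have [c ch ->] := mvt_between 0 h Dg.
have [d _ E] := mvt_between 0 c Ddg.
move: ch; rewrite !subr0 => ch.
rewrite [h * _]mulrC -mulrBl E subr0 !normrM expr2 mulrA.
by rewrite ler_wpM2r// ler_pM.
Qed.

Variable k : scalar_kind.
Local Notation K := (scalars R k).

Lemma is_derive_coord (c : K -> R) (n : nat) (f : 'rV[R]_n -> K) (x v : 'rV[R]_n) (t : R) :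
  (forall (a : R) x y, c (a *: x + y) = a * c x + c y) ->
  (forall x, `|c x| <= `|x|) ->
  derivable f (t *: v + x) v ->
  is_derive t 1 (fun t : R => c (f (t *: v + x))) (c ('D_v f (t *: v + x))).
Proof.
move=> cl cn /cvg_ex[/= l fl].
have Dl : 'D_v f (t *: v + x) = l by exact/cvg_lim.
have cB y z : c (y - z) = c y - c z by rewrite addrC -scaleN1r cl mulN1r addrC.
have c0 : c 0 = 0 by have := cB 0 0; rewrite !subrr.
have cZ (a : R) y : c (a *: y) = a * c y by rewrite -[a *: y]addr0 cl c0 addr0.
have cvgl : (fun h : R => h^-1 *: (((fun t : R => c (f (t *: v + x))) \o shift t) (h *: 1)
   - c (f (t *: v + x)))) @ 0^' --> c l.
  apply/cvgrPdist_lt => e e0.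
  have /cvgrPdist_lt/(_ e e0) := fl; apply: filterS => h /= hl.
  apply: le_lt_trans hl; rewrite -[X in `|_ - X|]/(h^-1 * _) -cB -cZ -cB.
  by rewrite [h%:A]mulr1 scalerDl addrA.
by apply: DeriveDef; [apply/cvg_ex; exists (c l)|rewrite Dl; exact/cvg_lim].
Qed.

Lemma taylor2 (n : nat) (f : 'rV[R]_n -> K) (x v : 'rV[R]_n) (M h : R) :
  (forall y, derivable f y v) -> (forall y, derivable ('D_v f) y v) ->
  (forall y, `|'D_v ('D_v f) y| <= M) ->
  `|f (h *: v + x) - f x - h *: 'D_v f x| <= (M + M) * `|h| ^+ 2.
Proof.
move=> Df DDf fM; have [c [d [cl dl cn dn cd]]] := scalars_coord R k.
rewrite (le_trans (cd _))// mulrDl lerD//.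
- have cB y z : c (y - z) = c y - c z by rewrite addrC -scaleN1r cl mulN1r addrC.
  have c0 : c 0 = 0 by have := cB 0 0; rewrite !subrr.
  have cZ (a : R) y : c (a *: y) = a * c y by rewrite -[a *: y]addr0 cl c0 addr0.
  have := @taylor2_real (fun t => c (f (t *: v + x))) (fun t => c ('D_v f (t *: v + x)))
    (fun t => c ('D_v ('D_v f) (t *: v + x))) M h.
  rewrite scale0r add0r -cZ -!cB; apply=> t; try exact: is_derive_coord.
  exact: le_trans (cn _) _.
- have cB y z : d (y - z) = d y - d z by rewrite addrC -scaleN1r dl mulN1r addrC.
  have c0 : d 0 = 0 by have := cB 0 0; rewrite !subrr.
  have cZ (a : R) y : d (a *: y) = a * d y by rewrite -[a *: y]addr0 dl c0 addr0.
  have := @taylor2_real (fun t => d (f (t *: v + x))) (fun t => d ('D_v f (t *: v + x)))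
    (fun t => d ('D_v ('D_v f) (t *: v + x))) M h.
  rewrite scale0r add0r -cZ -!cB; apply=> t; try exact: is_derive_coord.
  exact: le_trans (dn _) _.
Qed.

Lemma derive_taylor (n : nat) (f : 'rV[R]_n -> K) (x v : 'rV[R]_n) (l : K) (M : R) :
  (forall h : R, `|f (h *: v + x) - f x - h *: l| <= M * `|h| ^+ 2) ->
  is_derive x v f l.
Proof.
move=> fM.
have cl : (fun h : R => h^-1 *: ((f \o shift x) (h *: v) - f x)) @ 0^' --> l.
  apply/cvgrPdist_lt => e e0.
  have M0 : 0 < `|M| + 1 by rewrite ltr_wpDl.
  have : \forall h \near 0^', `|h : R| < e / (`|M| + 1).
    apply: dnbhs0_lt; exact: divr_gt0.
  have : \forall h \near (0 : R)^', h != 0 by exact: nbhs_dnbhs_neq.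
  apply: filterS2 => h h0 he /=.
  rewrite distrC -[l in _ - l]scale1r -(mulVf h0) -scalerA -scalerBr normrZ normfV.
  rewrite ltr_pdivrMl ?normr_gt0// (le_lt_trans (fM h))// expr2 mulrA mulrC.
  rewrite ltr_pM2l ?normr_gt0//; move: he; rewrite ltr_pdivlMr//; apply: le_lt_trans.
  by rewrite mulrC ler_wpM2l// (le_trans (ler_norm _))// lerDl.
by apply: DeriveDef; [apply/cvg_ex; exists l|exact/cvg_lim].
Qed.

End taylor.

Section completeness.
Variables (R : realType) (k : scalar_kind) (n : nat).
Local Notation K := (scalars R k).
Local Notation S := (schwartz R k n).
Implicit Types (phi psi : S) (j : schwartz_index n).

Lemma le_of_limit (u : nat -> K) (l : K) (M : R) :
  (forall e : R, 0 < e -> exists N, forall i, (N <= i)%N -> `|u i - l| <= e) ->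
  (exists N, forall i, (N <= i)%N -> `|u i| <= M) -> `|l| <= M.
Proof.
move=> ul [N uM]; apply/ler_addgt0Pr => e e0.
have [N' uN'] := ul e e0.
rewrite -[l](subrK (u (maxn N N'))) (le_trans (ler_normD _ _))// addrC.
by rewrite lerD ?uM ?leq_maxl// distrC uN' ?leq_maxr.
Qed.

Lemma uniform_limit_scalars (T : topologicalType) (f : nat -> T -> K) (g : T -> K) :
  (forall a, continuous (f a)) ->
  (forall e : R, 0 < e -> exists N, forall x, `|f N x - g x| <= e) ->
  continuous g.
Proof.
move=> fc fg x; apply/cvgrPdist_lt => e e0.
have e3 : 0 < e / 3 by exact: divr_gt0.
have [N gN] := fg _ e3.
have /cvgrPdist_lt/(_ _ e3) := fc N x.
apply: filterS => y /= xy.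
have -> : g x - g y = - (f N x - g x) + (f N x - f N y) + (f N y - g y) by ring.
have -> : e = e / 3 + e / 3 + e / 3 by field.
rewrite (le_lt_trans (ler_normD _ _))// ltr_leD ?gN//.
by rewrite (le_lt_trans (ler_normD _ _))// ler_ltD// normrN.
Qed.

Let mono0 : {ffun 'I_n -> nat} := [ffun=> 0%N].

Lemma weighted_partial_mono0 s (f : 'rV[R]_n -> K) x :
  weighted_partial (mono0, s) f x = partial s f x.
Proof.
rewrite /weighted_partial /monomial big1 ?scale1r// => i _.
by rewrite ffunE expr0.
Qed.

Lemma le_partial s phi x : `|partial s phi x| <= seminorm (mono0, s) phi.
Proof. by rewrite -weighted_partial_mono0 le_seminorm. Qed.

Lemma weighted_partialB j phi psi x :
  weighted_partial j (phi - psi : S) x =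
  weighted_partial j phi x - weighted_partial j psi x.
Proof.
have -> : (phi - psi : S) = (fun x => (-1) * (psi : _ -> K) x + (phi : _ -> K) x) :> (_ -> K).
  by apply/funext => y; rewrite mulN1r addrC.
rewrite weighted_partial_linear; [|exact: schwartz_smooth..].
by rewrite mulN1r addrC.
Qed.

Lemma partialB s phi psi x :
  partial s (phi - psi : S) x = partial s phi x - partial s psi x.
Proof.
by rewrite -!weighted_partial_mono0 weighted_partialB.
Qed.

Lemma schwartz_complete (u : nat -> S) :
  (forall j (e : R), 0 < e -> exists N, forall a b, (N <= a)%N -> (N <= b)%N ->
     seminorm j (u a - u b : S) <= e) ->
  exists l : S, forall j (e : R), 0 < e ->
    exists N, forall a, (N <= a)%N -> seminorm j (u a - l : S) <= e.
Proof.
move=> uC.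
have /choice[g gP] : forall sx : seq 'I_n * 'rV[R]_n, exists l : K,
    forall e : R, 0 < e -> exists N, forall a, (N <= a)%N ->
      `|partial sx.1 (u a) sx.2 - l| <= e.
  move=> [s x]; apply: scalars_complete => e e0.
  have [N uN] := uC (mono0, s) e e0; exists N => a b Na Nb /=.
  by rewrite -partialB (le_trans (le_partial _ _ _))// uN.
have gU s (e : R) : 0 < e -> exists N, forall a x, (N <= a)%N ->
    `|partial s (u a) x - g (s, x)| <= e.
  move=> e0; have [N uN] := uC (mono0, s) e e0; exists N => a x Na.
  apply: (@le_of_limit (fun b => partial s (u a) x - partial s (u b) x)) => //.
    move=> d d0; have [N' gN'] := gP (s, x) d d0; exists N' => b Nb.
    by rewrite (_ : _ - _ = g (s, x) - partial s (u b) x) 1?distrC ?gN'//=; ring.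
  by exists N => b Nb; rewrite -partialB (le_trans (le_partial _ _ _))// uN.
have gcont s : continuous (fun x => g (s, x)).
  apply: (@uniform_limit_scalars _ (fun a => partial s (u a))).
    by move=> a; exact: (schwartz_smooth (u a) s).2.
  by move=> e /(gU s)[N gN]; exists N => x; exact: gN.
have gder s i x : is_derive x 'e_i (fun y => g (s, y)) (g (i :: s, x)).
  have [N uN] := uC (mono0, i :: i :: s) 1 ltr01.
  pose M := seminorm (mono0, i :: i :: s) (u N) + 1.
  apply: (@derive_taylor _ _ _ _ _ _ _ (M + M)) => h.
  pose v a := partial s (u a) (h *: 'e_i + x) - partial s (u a) x
    - h *: partial (i :: s) (u a) x.
  apply: (@le_of_limit v) => //; last first.
    exists N => a Na; rewrite /v /=; apply: taylor2.
    - by move=> y; exact: (schwartz_smooth (u a) s).1.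
    - by move=> y; exact: (schwartz_smooth (u a) (i :: s)).1.
    - move=> y; rewrite (le_trans (le_partial (i :: i :: s) (u a) y))//.
      rewrite -[u a](subrK (u N)) (le_trans (seminormD _ _ _))// addrC lerD//.
      exact: uN.
  move=> e e0.
  have e3 : 0 < e / 3 by exact: divr_gt0.
  have h0 : 0 < `|h| + 1 by rewrite ltr_wpDl.
  have [N1 gN1] := gU s _ e3.
  have [N2 gN2] := gU (i :: s) _ (divr_gt0 e3 h0).
  exists (maxn N1 N2) => a; rewrite geq_max => /andP[Na1 Na2].
  have -> : v a - (g (s, h *: 'e_i + x) - g (s, x) - h *: g (i :: s, x)) =
    (partial s (u a) (h *: 'e_i + x) - g (s, h *: 'e_i + x))
    - (partial s (u a) x - g (s, x))
    - h *: (partial (i :: s) (u a) x - g (i :: s, x)).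
    rewrite /v !scalerBr; ring.
  have -> : e = e / 3 + e / 3 + e / 3 by field.
  rewrite (le_trans (ler_normB _ _))// lerD//.
    by rewrite (le_trans (ler_normB _ _))// lerD// gN1.
  rewrite normrZ (le_trans (ler_wpM2l _ (gN2 a x Na2)))//.
  by rewrite mulrA ler_pdivrMr// mulrC ler_pM2l// lerDl.
pose g0 x := g ([::], x).
have g0s s : partial s g0 = fun x => g (s, x).
  elim: s => [//|i s /= ->]; apply/funext => x; exact: derive_val.
have g0smooth : smooth g0.
  move=> s; rewrite g0s; split=> [i x|]; last exact: gcont.
  exact: (@ex_derive _ _ _ _ _ _ _ (gder s i x)).
have gW j (e : R) : 0 < e -> exists N, forall a x, (N <= a)%N ->
    `|weighted_partial j (u a) x - weighted_partial j g0 x| <= e.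
  case: j => [w s] e0; have [N uN] := uC (w, s) e e0; exists N => a x Na.
  apply: (@le_of_limit (fun b => weighted_partial (w, s) (u a) x - weighted_partial (w, s) (u b) x)) => //.
    move=> d d0; have m0 : 0 < `|monomial w x| + 1 by rewrite ltr_wpDl.
    have [N' gN'] := gU s _ (divr_gt0 d0 m0); exists N' => b Nb.
    rewrite (_ : _ - _ = weighted_partial (w, s) g0 x - weighted_partial (w, s) (u b) x);
      last by ring.
    rewrite /weighted_partial /= g0s -scalerBr normrZ.
    rewrite distrC (le_trans (ler_wpM2l _ (gN' b x Nb)))//.
    by rewrite mulrA ler_pdivrMr// mulrC ler_pM2l// lerDl.
  by exists N => b Nb; rewrite -weighted_partialB (le_trans (le_seminorm _ _ _))// uN.
have g0S : g0 \in schwartz_fun R k n.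
  apply/schwartz_funP; split=> // j; have [N gN] := gW j 1 ltr01.
  exists (seminorm j (u N) + 1) => x.
  rewrite -[X in `|X|](subrK (weighted_partial j (u N) x)) addrC.
  by rewrite (le_trans (ler_normD _ _))// lerD ?le_seminorm// distrC gN.
exists (Schwartz g0S) => j e e0; have [N gN] := gW j e e0; exists N => a Na.
by apply: seminorm_le => x; rewrite weighted_partialB gN.
Qed.

End completeness.

Section uniform_boundedness.
Variables (R : realType) (k : scalar_kind) (n : nat).
Local Notation K := (scalars R k).
Local Notation S := (schwartz R k n).
Implicit Types (phi psi : S) (j : schwartz_index n).

(* An increasing sequence of seminorms dominating each [seminorm j]. *)
Definition qnorm (N : nat) phi : R :=
  \sum_(0 <= i < N) oapp (fun j => seminorm j phi) 0 (unpickle i).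

Let term_ge0 (o : option (schwartz_index n)) phi : 0 <= oapp (fun j => seminorm j phi) 0 o.
Proof. by case: o => //= j; exact: seminorm_ge0. Qed.

Lemma qnorm_ge0 N phi : 0 <= qnorm N phi.
Proof. by apply: sumr_ge0 => i _. Qed.

Lemma qnormD N phi psi : qnorm N (phi + psi) <= qnorm N phi + qnorm N psi.
Proof.
rewrite /qnorm -big_split /=; apply: ler_sum => i _.
by case: unpickle => [j|] /=; rewrite ?addr0// seminormD.
Qed.

Lemma qnormZ N (c : K) phi : qnorm N (c *: phi) <= `|c| * qnorm N phi.
Proof.
rewrite /qnorm mulr_sumr; apply: ler_sum => i _.
by case: unpickle => [j|] /=; rewrite ?mulr0// seminormZ_le.
Qed.

Lemma qnormN N phi : qnorm N (- phi) = qnorm N phi.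
Proof.
by apply: eq_bigr => i _; case: unpickle => [j|] //=; exact: seminormN.
Qed.

Lemma qnorm_mono N M phi : (N <= M)%N -> qnorm N phi <= qnorm M phi.
Proof.
move=> NM; rewrite /qnorm (big_cat_nat (n := N) (p := M))//= lerDl.
by apply: sumr_ge0 => i _.
Qed.

Lemma le_qnorm j N phi : (pickle j < N)%N -> seminorm j phi <= qnorm N phi.
Proof.
move=> jN; apply: le_trans (qnorm_mono phi jN).
rewrite /qnorm big_nat_recr//= pickleK /= lerDr.
by apply: sumr_ge0 => i _.
Qed.

Lemma qnorm_limit (u : nat -> S) (l : S) :
  (forall j (e : R), 0 < e ->
     exists N, forall a, (N <= a)%N -> seminorm j (u a - l : S) <= e) ->
  forall N (e : R), 0 < e -> exists M, forall a, (M <= a)%N -> qnorm N (u a - l) <= e.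
Proof.
move=> ul; elim=> [|N IH] e e0.
  by exists 0%N => a _; rewrite /qnorm big_geq// ltW.
have [M1 h1] := IH _ (divr_gt0 e0 (ltr0Sn _ 1)).
case E : (unpickle N : option (schwartz_index n)) => [j|].
  have [M2 h2] := ul j _ (divr_gt0 e0 (ltr0Sn _ 1)).
  exists (maxn M1 M2) => a; rewrite geq_max => /andP[a1 a2].
  rewrite /qnorm big_nat_recr//= E /= [leRHS]splitr lerD ?h2//; exact: h1.
exists M1 => a a1; rewrite /qnorm big_nat_recr//= E /= addr0.
rewrite (le_trans (h1 a a1))// ler_pdivrMr// ler_peMr// ?ler1n//; exact: ltW.
Qed.

Definition qbounded (T : S -> K) (N : nat) (C : R) :=
  forall phi, `|T phi| <= C * qnorm N phi.

Section banach_steinhaus.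
Variables (I : Type) (T : I -> S -> K).
Hypothesis Tlin : forall i (c : K) phi psi, T i (c *: phi + psi) = c * T i phi + T i psi.
Hypothesis Tbnd : forall i, exists N C, qbounded (T i) N C.
Hypothesis Tpt : forall phi, exists M : R, forall i, `|T i phi| <= M.

Let TB i phi psi : T i (phi - psi) = T i phi - T i psi.
Proof. by rewrite addrC -scaleN1r Tlin mulN1r addrC. Qed.

Let T0 i : T i 0 = 0.
Proof. by have := TB i 0 0; rewrite !subrr. Qed.

Let TZ i c phi : T i (c *: phi) = c * T i phi.
Proof. by rewrite -[c *: phi]addr0 Tlin T0 addr0. Qed.

Let TD i phi psi : T i (phi + psi) = T i phi + T i psi.
Proof. by rewrite -[phi]scale1r Tlin mul1r scale1r. Qed.

Lemma real_scalar_norm (t : R) : 0 <= t -> `|t *: (1 : K)| = t.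
Proof. by move=> t0; rewrite normrZ scalars_norm1 mulr1 ger0_norm. Qed.

Let normTZ i (t : R) phi : 0 <= t -> `|T i ((t *: (1 : K)) *: phi)| = t * `|T i phi|.
Proof. by move=> t0; rewrite TZ scalars_normM real_scalar_norm. Qed.

(* One step of a nested ball construction.  A state (x, N, d) stands for the
   ball of center x and radius d for [qnorm N]. *)
Lemma hump (bad : forall N C, 0 <= C -> exists i phi, C * qnorm N phi < `|T i phi|)
  (p : (S * nat * R) * nat) : exists p' : S * nat * R, 0 < p.1.2 ->
  [/\ qnorm p.1.1.2 (p'.1.1 - p.1.1.1) <= p.1.2 / 2,
      (p.1.1.2 <= p'.1.2)%N /\ (p.2 < p'.1.2)%N,
      0 < p'.2 /\ p'.2 <= p.1.2 / 2, p'.2 <= p.2.+1%:R^-1 &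
      exists i, forall y, qnorm p'.1.2 (y - p'.1.1) <= p'.2 -> p.2%:R <= `|T i y| ].
Proof.
case: p => [[[x N] d] m] /=; case: (ltP 0 d) => d0; last by exists (x, N, d).
have m0 : 0 < m.+1%:R :> R by rewrite ltr0n.
have [|i [xi ixi]] := bad N (2 * m.+1%:R / d).
  by rewrite divr_ge0 ?mulr_ge0// ltW.
have t0 : 0 < `|T i xi|.
  by apply: le_lt_trans ixi; rewrite mulr_ge0 ?qnorm_ge0// divr_ge0 ?mulr_ge0// ltW.
pose s := m.+1%:R / `|T i xi|; pose z := (s *: (1 : K)) *: xi.
have s0 : 0 < s by rewrite divr_gt0.
have Tz : `|T i z| = m.+1%:R by rewrite normTZ ?ltW// mulfVK ?gt_eqF.
have qz : qnorm N z <= d / 2.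
  rewrite (le_trans (qnormZ _ _ _))// (real_scalar_norm (ltW s0))//.
  rewrite /s mulrAC ler_pdivrMr//.
  have -> : m.+1%:R * qnorm N xi = d / 2 * (2 * m.+1%:R / d * qnorm N xi).
    by field; rewrite gt_eqF.
  by rewrite ler_wpM2l ?divr_ge0// ltW.
have [x' [qx' Tx']] : exists x', qnorm N (x' - x) <= d / 2 /\ m.+1%:R <= `|T i x'|.
  have [h|h] := leP m.+1%:R `|T i (x + z)|.
    by exists (x + z); rewrite addrAC subrr add0r.
  have [h'|h'] := leP m.+1%:R `|T i (x - z)|.
    by exists (x - z); rewrite addrAC subrr add0r qnormN.
  have : `|T i (x + z) - T i (x - z)| < m.+1%:R + m.+1%:R.
    by rewrite (le_lt_trans (ler_normB _ _))// ltrD.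
  rewrite -TB opprB addrC addrA subrK TD -mulr2n normrMn Tz mulr2n ltxx.
  by [].
have [M [C iMC]] := Tbnd i.
have C0 : 0 < `|C| + 1 by rewrite ltr_wpDl.
exists (x', maxn m.+1 (maxn N M), Num.min (d / 2) (Num.min m.+1%:R^-1 (`|C| + 1)^-1)).
move=> _ /=; split=> //.
- by rewrite leq_max leq_maxl orbT leq_maxl.
- by rewrite !lt_min divr_gt0// !invr_gt0 m0 C0 ge_min lexx.
- by rewrite !ge_min lexx orbT.
exists i => y; rewrite !le_min => /and3P[_ _ yC].
have : `|T i (y - x')| <= 1.
  rewrite (le_trans (iMC _))// (@le_trans _ _ ((`|C| + 1) * qnorm M (y - x')))//.
    rewrite ler_wpM2r ?qnorm_ge0// (le_trans (ler_norm _))// lerDl//.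
  rewrite -ler_pdivlMl// mulr1; apply: le_trans yC; apply: qnorm_mono.
  by rewrite !leq_max leqnn !orbT.
rewrite TB distrC => h.
have := ler_normD (T i x' - T i y) (T i y).
by rewrite subrK => h'; move: Tx'; rewrite -natr1; lra.
Qed.

Lemma banach_steinhaus : exists N C, 0 <= C /\ forall i, qbounded (T i) N C.
Proof.
apply: contrapT => nH.
have bad N C : 0 <= C -> exists i phi, C * qnorm N phi < `|T i phi|.
  move=> C0; apply: contrapT => nH'; apply: nH; exists N, C; split=> // i phi.
  by rewrite leNgt; apply/negP => h; apply: nH'; exists i, phi.
have /choice[F FP] := hump bad.
pose st := fix st m := if m is m'.+1 then F (st m', m') else (0 : S, 0%N, 1 : R).
pose x m := (st m).1.1; pose N m := (st m).1.2; pose d m := (st m).2.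
have d0 m : 0 < d m.
  by elim: m => [|m IH]; [exact: ltr01|have [_ _ []] := FP (st m, m) IH].
have step m : [/\ qnorm (N m) (x m.+1 - x m) <= d m / 2,
    (N m <= N m.+1)%N /\ (m < N m.+1)%N, d m.+1 <= d m / 2, d m.+1 <= m.+1%:R^-1 &
    exists i, forall y, qnorm (N m.+1) (y - x m.+1) <= d m.+1 -> m%:R <= `|T i y|].
  by have [? ? [] *] := FP (st m, m) (d0 m); split.
have Nmono m l : (N m <= N (l + m))%N.
  elim: l => // l IH; apply: leq_trans IH _; rewrite addSn.
  by have [_ []] := step (l + m)%N.
have walk m l : qnorm (N m) (x (l + m)%N - x m) <= d m - d (l + m)%N.
  elim: l => [|l IH]; first by rewrite !subrr /qnorm big1// => i _; case: unpickle => //= j; rewrite seminorm0.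
  rewrite -[x (l.+1 + m)%N](subrK (x (l + m)%N)) -addrA (le_trans (qnormD _ _ _))//.
  have [h _ h' _ _] := step (l + m)%N; rewrite addSn.
  have := le_trans (qnorm_mono _ (Nmono m l)) h; lra.
have walk' m a : (m <= a)%N -> qnorm (N m) (x a - x m) <= d m.
  by move=> ma; have := walk m (a - m)%N; rewrite subnK//; have := d0 a; lra.
have dsmall (e : R) : 0 < e -> exists m, forall a, (m <= a)%N -> d a <= e.
  move=> e0; exists (Num.truncn e^-1).+1 => -[//|a]; rewrite ltnS => ea.
  have [_ _ _ h _] := step a; apply: (le_trans h).
  rewrite invf_ple ?posrE ?ltr0n// ltW// (lt_le_trans (truncnS_gt _))//.
  by rewrite ler_nat ltnS.
have [l xl] : exists l : S, forall j (e : R), 0 < e ->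
    exists M, forall a, (M <= a)%N -> seminorm j (x a - l : S) <= e.
  apply: schwartz_complete => j e e0.
  have [m dm] := dsmall _ (divr_gt0 e0 (ltr0Sn _ 1)).
  pose M := maxn m (pickle j).+2; exists M => a b Ma Mb.
  have dM : d M <= e / 2 by apply: dm; rewrite leq_maxl.
  have jN : (pickle j < N M)%N.
    rewrite /M; case: (maxn _ _) (leq_maxr m (pickle j).+2) => // p; rewrite ltnS => jp.
    by have [_ [_ h] _ _ _] := step p; apply: ltn_trans h.
  rewrite -[x a](subrK (x M)) -addrA (le_trans (seminormD _ _ _))//.
  have ha := le_trans (le_qnorm _ jN) (walk' M a Ma).
  have hb := le_trans (le_qnorm _ jN) (walk' M b Mb).
  by rewrite (seminormB _ (x M)); lra.
have lin m : qnorm (N m) (l - x m) <= d m.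
  apply/ler_addgt0Pr => e e0; have [M hM] := qnorm_limit xl (N m) e0.
  rewrite -[l](subrK (x (maxn m M))) -addrA (le_trans (qnormD _ _ _))// [leRHS]addrC lerD//.
    by rewrite -opprB qnormN hM ?leq_maxr.
  by rewrite walk' ?leq_maxl.
have [M TM] := Tpt l.
have [_ _ _ _ [i iP]] := step (Num.truncn M).+1.
have := le_trans (iP l (lin _)) (TM i).
by rewrite leNgt truncnS_gt.
Qed.

End banach_steinhaus.

Lemma continuous_qbounded (u : S -> K^o) : linear u -> continuous (u : S -> K) ->
  exists N C, qbounded u N C.
Proof.
move=> lu cu.
have u0 : u 0 = 0.
  by have := lu (-1) 0 0; rewrite scaler0 addr0 scaleN1r addNr.
have uZ c phi : u (c *: phi) = c * u phi.
  by rewrite -[c *: phi]addr0 lu u0 addr0.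
have /cvgrPdist_lt/(_ 1 ltr01) := cu 0.
rewrite u0 => -[F [e [e0 FP]]].
pose N := (\max_(j <- F) (pickle j).+1)%N.
have FN j phi : j \in F -> seminorm j phi <= qnorm N phi.
  by move=> jF; apply: le_qnorm; rewrite /N (big_rem j)//= leq_maxl.
exists N, (2 / e) => phi; rewrite leNgt; apply/negP => h.
have t0 : 0 < `|u phi : K|.
  by apply: le_lt_trans h; rewrite mulr_ge0 ?qnorm_ge0// divr_ge0// ltW.
have ti0 : 0 <= `|u phi : K|^-1 by rewrite invr_ge0.
have : ball_ Num.norm 0 1 (u ((`|u phi : K|^-1 *: (1 : K)) *: phi) : K).
  apply: FP => j jF; rewrite subr0 (le_lt_trans (seminormZ_le _ _ _))//.
  rewrite real_scalar_norm// mulrC ltr_pdivrMr//.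
  rewrite (le_lt_trans (FN _ _ jF))//.
  have e20 : 0 < 2 / e by exact: divr_gt0.
  move: h; rewrite -ltr_pdivlMl// => /lt_le_trans; apply.
  rewrite ler_wpM2r ?normr_ge0// invf_div ler_pdivrMr// ler_peMr ?ltW//.
  by rewrite ltr1n.
rewrite /ball_ /= sub0r normrN uZ scalars_normM real_scalar_norm//.
by rewrite mulVf ?gt_eqF// ltxx.
Qed.

End uniform_boundedness.

Section operators.
Variables (R : realType) (k : scalar_kind).
Local Notation K := (scalars R k).

Lemma schwartz_linear_combE n (c : K) (f g : schwartz R k n) :
  (c *: f + g : schwartz R k n) = (fun x => c * (f : _ -> K) x + (g : _ -> K) x) :> (_ -> K).
Proof. by []. Qed.

Lemma nbhs_qnorm n N (phi : schwartz R k n) (e : R) : 0 < e ->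
  nbhs phi [set psi : schwartz R k n | qnorm N (psi - phi) < e].
Proof.
move=> e0; exists (pmap unpickle (iota 0 N)), (e / N.+1%:R).
have N0 : 0 < N.+1%:R :> R by rewrite ltr0n.
split=> [|psi H /=]; first exact: divr_gt0.
have : qnorm N (psi - phi) <= \sum_(0 <= i < N) (e / N.+1%:R).
  rewrite /qnorm !big_seq; apply: ler_sum => i; rewrite mem_index_iota => /= iN.
  case E : (unpickle i : option (schwartz_index n)) => [j|] /=; last exact/ltW/divr_gt0.
  apply/ltW/H; rewrite mem_pmap -E map_f// mem_iota add0n; exact: iN.
move=> /le_lt_trans; apply; rewrite big_const_nat iter_addr_0 subn0 -[_ *+ N]mulr_natr.
by rewrite mulrAC ltr_pdivrMr// ltr_pM2l// ltr_nat.
Qed.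

Lemma qbounded_continuous m n (A : schwartz R k n -> schwartz R k m) : linear A ->
  (forall j, exists N C, 0 <= C /\
    forall phi, seminorm j (A phi) <= C * qnorm N phi) ->
  continuous A.
Proof.
move=> lA Ab phi U [F [e [e0 FU]]].
have AB psi chi : A (psi - chi) = A psi - A chi.
  by rewrite addrC -scaleN1r lA scaleN1r addrC.
suff : nbhs phi [set psi | forall j, j \in F -> seminorm j (A psi - A phi : schwartz R k m) < e].
  by apply: filterS => psi H; exact: FU.
elim: F {FU} => [|j F IH].
  by apply: filterS (@filterT _ (nbhs phi) _).
have [N [C [C0 AC]]] := Ab j.
have C1 : 0 < C + 1 by rewrite ltr_wpDl.
apply: filterS2 IH (nbhs_qnorm N phi (divr_gt0 e0 C1)) => psi H1 H2 i; rewrite /mkset in H2.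
rewrite inE => /orP[/eqP ->|]; last exact: H1.
rewrite -AB (le_lt_trans (AC _))//; move: H2; rewrite ltr_pdivlMr// mulrC.
by apply: le_lt_trans; rewrite ler_wpM2r ?qnorm_ge0// lerDl.
Qed.

(* A closed graph theorem: by uniform boundedness, a linear operator between
   Schwartz spaces is continuous as soon as all its point evaluations are. *)
Lemma pointwise_continuous m n (A : schwartz R k n -> schwartz R k m) :
  linear A ->
  (forall x, exists N C, qbounded (fun phi => A phi x : K) N C) ->
  continuous A.
Proof.
move=> lA A0.
have pA s x (c : K) phi psi : partial s (A (c *: phi + psi)) x =
    c * partial s (A phi) x + partial s (A psi) x.
  by rewrite lA schwartz_linear_combE partial_linear//; exact: schwartz_smooth.
have As s x : exists N C, qbounded (fun phi => partial s (A phi) x) N C.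
  elim: s x => [|i s IH] x; first exact: A0.
  pose h (l : nat) : R := l.+1%:R^-1.
  have h0 l : 0 < h l by rewrite invr_gt0 ltr0n.
  pose T l phi : K :=
    (h l)^-1 *: (partial s (A phi) (h l *: 'e_i + x) - partial s (A phi) x).
  have TP phi : exists M : R, 0 <= M /\
      forall l, `|T l phi - partial (i :: s) (A phi) x| <= M * h l.
    pose M := seminorm ([ffun=> 0%N], i :: i :: s) (A phi).
    exists (M + M); split; first by rewrite addr_ge0// seminorm_ge0.
    move=> l; have := @taylor2 R k m (partial s (A phi)) x 'e_i M (h l).
    rewrite (ger0_norm (ltW (h0 l))) => H.
    have -> : T l phi - partial (i :: s) (A phi) x = (h l)^-1 *:
        (partial s (A phi) (h l *: 'e_i + x) - partial s (A phi) x
           - h l *: 'D_('e_i) (partial s (A phi)) x).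
      by rewrite [in RHS]scalerBr scalerA mulVf ?gt_eqF// scale1r.
    rewrite normrZ ger0_norm ?invr_ge0 ?(ltW (h0 l))// ler_pdivrMl//.
    rewrite [leRHS](_ : _ = (M + M) * h l ^+ 2); last by ring.
    apply: H => [y|y|y].
    - exact: (schwartz_smooth (A phi) s).1.
    - exact: (schwartz_smooth (A phi) (i :: s)).1.
    - exact: (le_partial (i :: i :: s) (A phi) y).
  have [|||N [C [C0 TC]]] := @banach_steinhaus R k n nat T.
  - move=> l c phi psi; rewrite /T !pA -scalars_scaleAr -scalerDr; congr (_ *: _).
    ring.
  - move=> l; have [N1 [C1 h1]] := IH x.
    have [N2 [C2 h2]] := IH (h l *: 'e_i + x).
    exists (maxn N1 N2), ((h l)^-1 * (`|C2| + `|C1|)) => phi.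
    rewrite /T normrZ ger0_norm ?invr_ge0 ?(ltW (h0 l))// -mulrA.
    rewrite ler_wpM2l ?invr_ge0 ?(ltW (h0 l))// mulrDl (le_trans (ler_normB _ _))//.
    apply: lerD.
      rewrite (le_trans (h2 phi))// (le_trans (ler_wpM2r (qnorm_ge0 _ _) (ler_norm _)))//.
      by rewrite ler_wpM2l// qnorm_mono// leq_maxr.
    rewrite (le_trans (h1 phi))// (le_trans (ler_wpM2r (qnorm_ge0 _ _) (ler_norm _)))//.
    by rewrite ler_wpM2l// qnorm_mono// leq_maxl.
  - move=> phi; have [M [M0 TM]] := TP phi.
    exists (M + `|partial (i :: s) (A phi) x|) => l.
    rewrite -[T l phi](subrK (partial (i :: s) (A phi) x)).
    rewrite (le_trans (ler_normD _ _))// lerD// (le_trans (TM l))//.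
    by rewrite ler_piMr// invf_le1 ?ltr0n// ler1n.
  exists N, C => phi; apply: (@le_of_limit _ _ (T^~ phi)); last by exists 0%N => l _; exact: TC.
  move=> e e0; have [M [M0 TM]] := TP phi.
  exists (Num.truncn (M / e)) => l Ml; rewrite (le_trans (TM l))//.
  rewrite ler_pdivrMr ?ltr0n// mulrC -ler_pdivrMr// ltW//.
  by rewrite (lt_le_trans (truncnS_gt _))// ler_nat ltnS.
apply: qbounded_continuous => // j.
have [|||N [C [C0 TC]]] := @banach_steinhaus R k n _
    (fun x phi => weighted_partial j (A phi) x).
- move=> x c phi psi; rewrite /weighted_partial pA scalerDr.
  by rewrite scalars_scaleAr.
- move=> x; have [N [C NC]] := As j.2 x.
  exists N, (`|monomial j.1 x| * C) => phi.
  by rewrite /weighted_partial normrZ -mulrA ler_wpM2l.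
- by move=> phi; exists (seminorm j (A phi)) => x; exact: le_seminorm.
exists N, C; split=> // phi; apply: seminorm_le => x; exact: TC.
Qed.

Record schwartz_operator (n m : nat) := SchwartzOperator {
  operator_fun :> schwartz R k n -> schwartz R k m;
  operator_linear : linear operator_fun;
  operator_continuous : continuous operator_fun }.

Lemma comp_operator_linear l m n (B : schwartz_operator m l)
  (A : schwartz_operator n m) : linear (B \o A).
Proof. by move=> c f g /=; rewrite !operator_linear. Qed.

Lemma comp_operator_continuous l m n (B : schwartz_operator m l)
  (A : schwartz_operator n m) : continuous (B \o A).
Proof.
move=> f; exact: (continuous_comp (@operator_continuous _ _ A f)
  (@operator_continuous _ _ B (A f))).
Qed.

Definition comp_operator l m n (B : schwartz_operator m l)
    (A : schwartz_operator n m) : schwartz_operator n l :=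
  SchwartzOperator (comp_operator_linear B A)
    (@comp_operator_continuous l m n B A).

Lemma transpose_subproof n m (A : schwartz_operator n m) (a : tempered R k m) :
  (a \o A : schwartz R k n -> (scalars R k)^o) \in tempered_fun R k n.
Proof.
have /tempered_funP[la ca] := tempered_valP a.
apply/tempered_funP; split=> [c f g|f] /=.
  by rewrite operator_linear la.
exact: (continuous_comp (@operator_continuous _ _ A f) (ca (A f))).
Qed.

Definition transpose n m (A : schwartz_operator n m) (a : tempered R k m) :
  tempered R k n := Tempered (transpose_subproof A a).

(* The space O_M. *)
Record multiplier (m : nat) := Multiplier {
  multiplier_fun :> 'rV[R]_m -> K;
  multiplier_smooth : smooth multiplier_fun;
  multiplierP : forall phi : schwartz R k m,
    (fun x => (phi x : K) * multiplier_fun x) \in schwartz_fun R k m }.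

Lemma mul_subproof m (f : multiplier m) (g : schwartz R k m) :
  (fun x => f x * (g x : K)) \in schwartz_fun R k m.
Proof. by under eq_fun do rewrite mulrC; exact: multiplierP. Qed.

Definition mul_fun m (f : multiplier m) (g : schwartz R k m) : schwartz R k m :=
  Schwartz (mul_subproof f g).

Lemma mul_linear m (f : multiplier m) : linear (mul_fun f).
Proof.
move=> c g h; apply: val_inj; apply/funext => x.
change (f x * (c * (g x : K) + h x) = c * (f x * (g x : K)) + f x * (h x : K)).
ring.
Qed.

Lemma mul_continuous m (f : multiplier m) : continuous (mul_fun f).
Proof.
apply: pointwise_continuous; first exact: mul_linear.
move=> x; pose j : schwartz_index m := ([ffun=> 0%N], [::]).
exists (pickle j).+1, `|f x| => phi.
rewrite /mul_fun /= scalars_normM ler_wpM2l//.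
exact: le_trans (le_partial [::] phi x) (le_qnorm phi (leqnn _)).
Qed.

Definition mul_operator m (f : multiplier m) : schwartz_operator m m :=
  SchwartzOperator (mul_linear f) (@mul_continuous m f).

(* The multiplication a |-> f a of a tempered distribution by f in O_M:
   (f a)(g) = a (f g). *)
Definition mul_tempered m (f : multiplier m) (a : tempered R k m) :
  tempered R k m := transpose (mul_operator f) a.

Definition is_schwartz_family m n (v : 'rV[R]_m -> tempered R k n) :=
  forall phi : schwartz R k n, (fun p => v p phi) \in schwartz_fun R k m.

Record schwartz_family (m n : nat) := SchwartzFamily {
  family_fun :> 'rV[R]_m -> tempered R k n;
  familyP : is_schwartz_family family_fun }.

Definition family_eval m n (v : schwartz_family m n) (phi : schwartz R k n) :
  schwartz R k m := Schwartz (familyP v phi).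

Lemma family_linear m n (v : schwartz_family m n) : linear (family_eval v).
Proof.
move=> c f g; apply: val_inj; apply/funext => p /=.
by have /tempered_funP[lv _] := tempered_valP (v p); rewrite lv.
Qed.

Lemma tempered_qbounded n (u : tempered R k n) :
  exists N C, qbounded (u : _ -> K) N C.
Proof.
have /tempered_funP[lu cu] := tempered_valP u; exact: continuous_qbounded lu cu.
Qed.

Lemma family_continuous m n (v : schwartz_family m n) : continuous (family_eval v).
Proof.
apply: pointwise_continuous; first exact: family_linear.
move=> p; exact: (tempered_qbounded (v p)).
Qed.

Definition family_operator m n (v : schwartz_family m n) : schwartz_operator n m :=
  SchwartzOperator (family_linear v) (@family_continuous m n v).

Definition superposition m n (a : tempered R k m) (v : schwartz_family m n) :
  tempered R k n := transpose (family_operator v) a.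

End operators.

Arguments schwartz_operator R k n m : clear implicits.
Arguments multiplier R k m : clear implicits.
Arguments schwartz_family R k m n : clear implicits.

(* Main.v *)
Require Import Defs.
From HB Require Import structures.
From mathcomp Require Import all_boot all_order all_algebra.
From mathcomp Require Import all_classical all_reals all_analysis.
Import GRing.Theory Num.Theory.
Import numFieldNormedType.Exports.
Local Open Scope ring_scope.

(** Everything rests on one pointwise identity: for a test function [phi], the function
    [p |-> (f p *: v p) phi] is the product of [f] with the Schwartz function [family_eval v phi].
    Multipliers preserve Schwartz functions, so the scaled family is Schwartz, and the same identity
    factors its operator as multiplication by [f] after that of [v]. Transposition reverses this
    composition ([transpose_comp]); evaluating at [a] gives the formula for superpositions. *)

(** Linearity and continuity are propositions, so proof irrelevance leaves only the underlying maps
    to compare. *)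
Lemma schwartz_operator_ext (R : realType) (k : scalar_kind) (n m : nat)
    (A B : schwartz_operator R k n m) : A =1 B -> A = B.
Proof.
case: A B => [A lA cA] [B lB cB] /= /funext AB; move: AB lA cA lB cB => -> *.
by congr SchwartzOperator; exact: Prop_irrelevance.
Qed.

(** At [a], both sides have the underlying functional [a \o B \o A]. *)
Lemma transpose_comp (R : realType) (k : scalar_kind) (l m n : nat)
    (B : schwartz_operator R k m l) (A : schwartz_operator R k n m) :
  transpose (comp_operator B A) = transpose A \o transpose B.
Proof. by apply/funext => a; exact: val_inj. Qed.

Lemma scaled_family_is_schwartz (R : realType) (k : scalar_kind) (m n : nat)
    (v : schwartz_family R k m n) (f : multiplier R k m) :
  is_schwartz_family (fun p : 'rV[R]_m => f p *: v p).
Proof. by move=> phi; exact: (mul_subproof f (family_eval v phi)). Qed.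

Theorem mainTheorem1 (R : realType) (k : scalar_kind) (m n : nat)
    (hm : (1 <= m)%N) (hn : (1 <= n)%N)
    (v : schwartz_family R k m n) (f : multiplier R k m) :
  exists hfv : is_schwartz_family (fun p : 'rV[R]_m => f p *: v p),
    let fv : schwartz_family R k m n := SchwartzFamily hfv in
    [/\ family_operator fv = comp_operator (mul_operator f) (family_operator v),
        transpose (family_operator fv) =
          transpose (family_operator v) \o transpose (mul_operator f) &
        forall a : tempered R k m,
          superposition a fv = superposition (mul_tempered f a) v].
Proof.
exists (scaled_family_is_schwartz R k m n v f) => fv.
have fvE : family_operator fv =
    comp_operator (mul_operator f) (family_operator v).
  (* Scaling in [K^o] is multiplication in [K], so both values at [phi] are convertible to
     [p |-> f p * v p phi]. *)
  by apply: schwartz_operator_ext => phi; exact: val_inj.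
have tE : transpose (family_operator fv) =
    transpose (family_operator v) \o transpose (mul_operator f).
  by rewrite fvE transpose_comp.
(* [mul_tempered f a] unfolds to [transpose (mul_operator f) a]. *)
by split=> // a; rewrite /superposition tE.
Qed.
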